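(* Let $\mathcal{G}$ be a dipath space, let $A,B\subseteq V(\mathcal{G})$ and let $k$ be a natural number. Then either there exists a set $X\subseteq V(\mathcal{G})$ with $|X|<k$ meeting every $A$–$B$-path in $\mathcal{G}$, or there exists a set of $k$ pairwise disjoint $A$–$B$-paths in $\mathcal{G}$.
   Context: A subset $Y$ of a linearly ordered set $X$ is called complete (in $X$) if every nonempty $Z \subseteq Y$ has a supremum and an infimum in $X$ and both lie in $Y$. A path is a linearly ordered set $(P,\le_P)$ that is complete in itself. Distinct paths may share elements; intersections and unions of paths refer to their underlying sets; paths are disjoint if their underlying sets are disjoint. A set of paths is compatible if for any two paths $P,Q$ in it, $P\cap Q$ is complete in $P$ (with the order of $P$). For $x \le y$ in a path $P$, the segment of $P$ from $x$ to $y$ is the interval $[x,y]$ of $P$ with the induced order. A path $P$ connects to a path $Q$ if $P \cap Q=\{x\}$ where $x=\max P=\min Q$; in this case the concatenation of $P$ and $Q$ is $P\cup Q$ with the order extending both orders in which every element of $P$ precedes every element of $Q$. A dipath space is a compatible set of paths closed under segments and under concatenations (whenever $P,Q$ are members and $P$ connects to $Q$, their concatenation is a member). $V(\mathcal{G})$ is the union of the underlying sets of the paths of $\mathcal{G}$. An $A$–$B$-path in $\mathcal{G}$ is a path $R\in\mathcal{G}$ with $R\cap A=\{\min R\}$ and $R\cap B=\{\max R\}$. A set meets a path if it intersects its underlying set. *)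

(* Defs.v *)
From Stdlib Require Import List.

Set Implicit Arguments.

Section Dipaths.
Variable V : Type.

(* A candidate path: an underlying set together with a relation (the order).
   Paths are members of this type; distinct paths may share elements. *)
Record dpath := DPath { pset : V -> Prop; pord : V -> V -> Prop }.

Definition linear_order_on (S : V -> Prop) (le : V -> V -> Prop) : Prop :=
  (forall a b, le a b -> S a /\ S b) /\
  (forall a, S a -> le a a) /\
  (forall a b, le a b -> le b a -> a = b) /\
  (forall a b c, le a b -> le b c -> le a c) /\
  (forall a b, S a -> S b -> le a b \/ le b a).

Definition is_sup (X : V -> Prop) (le : V -> V -> Prop) (Z : V -> Prop) (s : V) :=
  X s /\ (forall z, Z z -> le z s) /\
  (forall u, X u -> (forall z, Z z -> le z u) -> le s u).
Definition is_inf (X : V -> Prop) (le : V -> V -> Prop) (Z : V -> Prop) (s : V) :=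
  X s /\ (forall z, Z z -> le s z) /\
  (forall u, X u -> (forall z, Z z -> le u z) -> le u s).

Definition complete_in (X : V -> Prop) (le : V -> V -> Prop) (Y : V -> Prop) :=
  forall Z : V -> Prop, (forall z, Z z -> Y z) -> (exists z, Z z) ->
    (exists s, is_sup X le Z s /\ Y s) /\ (exists i, is_inf X le Z i /\ Y i).

Definition is_path (P : dpath) : Prop :=
  linear_order_on (pset P) (pord P) /\ complete_in (pset P) (pord P) (pset P).

Definition is_min (P : dpath) (m : V) := pset P m /\ forall x, pset P x -> pord P m x.
Definition is_max (P : dpath) (m : V) := pset P m /\ forall x, pset P x -> pord P x m.

Definition segment (P : dpath) (x y : V) : dpath :=
  let S := fun z => pset P z /\ pord P x z /\ pord P z y in
  DPath S (fun a b => S a /\ S b /\ pord P a b).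

Definition connects (P Q : dpath) : Prop :=
  exists x, (forall z, (pset P z /\ pset Q z) <-> z = x) /\ is_max P x /\ is_min Q x.

Definition concat (P Q : dpath) : dpath :=
  DPath (fun z => pset P z \/ pset Q z)
        (fun a b => pord P a b \/ pord Q a b \/ (pset P a /\ pset Q b)).

Definition compatible (G : dpath -> Prop) : Prop :=
  forall P Q, G P -> G Q -> complete_in (pset P) (pord P) (fun z => pset P z /\ pset Q z).

Definition dipath_space (G : dpath -> Prop) : Prop :=
  (forall P, G P -> is_path P) /\
  compatible G /\
  (forall P x y, G P -> pset P x -> pset P y -> pord P x y -> G (segment P x y)) /\
  (forall P Q, G P -> G Q -> connects P Q -> G (concat P Q)).

Definition vertices (G : dpath -> Prop) (x : V) : Prop := exists P, G P /\ pset P x.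

Definition AB_path (G : dpath -> Prop) (A B : V -> Prop) (R : dpath) : Prop :=
  G R /\
  (exists m, is_min R m /\ forall z, (pset R z /\ A z) <-> z = m) /\
  (exists m, is_max R m /\ forall z, (pset R z /\ B z) <-> z = m).

Definition meets (X : V -> Prop) (R : dpath) : Prop := exists x, X x /\ pset R x.

Definition card_lt (X : V -> Prop) (k : nat) : Prop :=
  exists l : list V, length l < k /\ forall x, X x -> In x l.

End Dipaths.

(* Main.v *)
Require Import Defs.
From Stdlib Require Import List Arith Lia Classical ClassicalEpsilon.

(* Fix [n] disjoint A-B-paths. An alternating walk consists of finitely many
   jumps (members of [G] meeting the paths only in their end points), separated
   by steps backwards along the paths. If such a walk leads from [A] to [B]
   outside the paths, then there are [n + 1] disjoint paths. Otherwise take on each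
   path the infimum of the points from which a walk can be launched that reaches
   [B]. These [n] points form a separator: compatibility gives an A-B-path avoiding
   them a first point beyond the infima and a last point below them, and the
   segment in between would be a jump launched below an infimum. *)

Definition from_to {V : Type} (P : dpath V) (x y : V) : Prop :=
  is_min P x /\ is_max P y.

(** Induction on [n], comparing the least element of the last set with that of the earlier ones. The
    relation is left abstract because the separator argument uses it both for the order of a path
    and for the reverse order, where least means last. *)
Lemma finite_union_least {V : Type} (S : V -> Prop) (le : V -> V -> Prop)
    (n : nat) (C : nat -> V -> Prop) :
  (forall a b, S a -> S b -> le a b \/ le b a) ->
  (forall a b c, le a b -> le b c -> le a c) ->
  (forall i z, C i z -> S z) ->
  (forall i, i < n -> (exists z, C i z) ->
     exists m, C i m /\ forall u, C i u -> le m u) ->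
  (exists i z, i < n /\ C i z) ->
  exists i m, i < n /\ C i m /\ forall j u, j < n -> C j u -> le m u.
Proof.
  intros tot tr sub least. induction n as [|n IH]; intros [i [z [Hi Hz]]]; [lia|].
  destruct (classic (exists z, C n z)) as [Hn|Hn].
  - destruct (least n) as [m [Cm mle]]; [lia|assumption|].
    destruct (classic (exists i z, i < n /\ C i z)) as [He|He].
    + destruct IH as [i' [m' [Hi' [Cm' mle']]]];
        [intros; apply least; [lia|assumption]|exact He|].
      destruct (tot m m' (sub _ _ Cm) (sub _ _ Cm')) as [H|H].
      * exists n, m. split; [lia|split; [assumption|]]. intros j u Hj Cu.
        destruct (Nat.eq_dec j n) as [->|]; [now apply mle|].
        apply tr with m'; [assumption|]. apply mle' with j; [lia|assumption].
      * exists i', m'. split; [lia|split; [assumption|]]. intros j u Hj Cu.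
        destruct (Nat.eq_dec j n) as [->|]; [apply tr with m; auto|].
        apply mle' with j; [lia|assumption].
    + exists n, m. split; [lia|split; [assumption|]]. intros j u Hj Cu.
      destruct (Nat.eq_dec j n) as [->|]; [now apply mle|].
      exfalso. apply He. exists j, u. split; [lia|assumption].
  - assert (i <> n) by (intros ->; apply Hn; now exists z).
    destruct IH as [i' [m' [Hi' [Cm' mle']]]];
      [intros; apply least; [lia|assumption]|exists i, z; split; [lia|assumption]|].
    exists i', m'. split; [lia|split; [assumption|]]. intros j u Hj Cu.
    destruct (Nat.eq_dec j n) as [->|]; [exfalso; apply Hn; now exists u|].
    apply mle' with j; [lia|assumption].
Qed.

(** * Orders, segments and splicing in a dipath space *)

Section DipathSpace.
Variables (V : Type) (G : dpath V -> Prop).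
Hypothesis Gspace : dipath_space G.

Lemma pord_dom P a b : G P -> pord P a b -> pset P a /\ pset P b.
Proof.
  intros HP H. destruct Gspace as [GP _].
  destruct (GP P HP) as [[L _] _]. exact (L a b H).
Qed.

Lemma pord_refl P a : G P -> pset P a -> pord P a a.
Proof.
  intros HP H. destruct Gspace as [GP _].
  destruct (GP P HP) as [[_ [L _]] _]. exact (L a H).
Qed.

Lemma pord_antisym P a b : G P -> pord P a b -> pord P b a -> a = b.
Proof.
  intros HP. destruct Gspace as [GP _].
  destruct (GP P HP) as [[_ [_ [L _]]] _]. exact (L a b).
Qed.

Lemma pord_trans P a b c : G P -> pord P a b -> pord P b c -> pord P a c.
Proof.
  intros HP. destruct Gspace as [GP _].
  destruct (GP P HP) as [[_ [_ [_ [L _]]]] _]. exact (L a b c).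
Qed.

Lemma pord_total P a b : G P -> pset P a -> pset P b -> pord P a b \/ pord P b a.
Proof.
  intros HP. destruct Gspace as [GP _].
  destruct (GP P HP) as [[_ [_ [_ [_ L]]]] _]. exact (L a b).
Qed.

Lemma segment_from_to P x y : G P -> pord P x y ->
  G (segment P x y) /\ from_to (segment P x y) x y.
Proof.
  intros HP H. destruct (pord_dom _ _ _ HP H) as [Px Py].
  assert (pord P x x) by now apply pord_refl.
  assert (pord P y y) by now apply pord_refl.
  split; [now apply Gspace|].
  split; split; simpl; try tauto; intros z [Pz [Hz Hz']]; tauto.
Qed.

Lemma inter_least P Q : G P -> G Q -> (exists z, pset P z /\ pset Q z) ->
  exists m, (pset P m /\ pset Q m) /\ forall u, pset P u /\ pset Q u -> pord P m u.
Proof.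
  intros HP HQ He. destruct Gspace as [_ [cmp _]].
  destruct (cmp P Q HP HQ _ (fun z h => h) He) as [_ [i [[_ [Hi _]] Hm]]].
  now exists i.
Qed.

Lemma inter_greatest P Q : G P -> G Q -> (exists z, pset P z /\ pset Q z) ->
  exists m, (pset P m /\ pset Q m) /\ forall u, pset P u /\ pset Q u -> pord P u m.
Proof.
  intros HP HQ He. destruct Gspace as [_ [cmp _]].
  destruct (cmp P Q HP HQ _ (fun z h => h) He) as [[i [[_ [Hi _]] Hm]] _].
  now exists i.
Qed.

(** Compatibility gives a first point [t0] of [P] on [Q]. The segment of [P] up to [t0] then meets
    the segment of [Q] from [t0] only in [t0], so the two connect and [K] is their concatenation. *)
Lemma splice P Q x y s z t : G P -> G Q -> from_to P x y -> from_to Q s z ->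
  pset P t -> pset Q t ->
  exists t0 K, pset P t0 /\ pset Q t0 /\ pord P t0 t /\ G K /\ from_to K x z /\
    forall u, pset K u -> pord P u t0 \/ pord Q t0 u.
Proof.
  intros HP HQ [[Px Pmin] _] [_ [Qz Qmax]] Pt Qt.
  destruct (inter_least P Q HP HQ) as [t0 [[Pt0 Qt0] first]]; [now exists t|].
  destruct (segment_from_to P x t0 HP (Pmin _ Pt0)) as [G1 [[S1x S1min] [S1t S1max]]].
  destruct (segment_from_to Q t0 z HQ (Qmax _ Qt0)) as [G2 [[S2t S2min] [S2z S2max]]].
  exists t0, (Defs.concat (segment P x t0) (segment Q t0 z)).
  split; [assumption|]. split; [assumption|]. split; [now apply first|].
  split; [|split; [split; split|]].
  - apply Gspace; [assumption|assumption|]. exists t0. split; [|split; split; assumption].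
    intros u. split; [|now intros ->].
    intros [[Pu [_ Hu]] [Qu _]]. apply pord_antisym with P; [assumption..|]. now apply first.
  - now left.
  - intros u [Hu|Hu]; [left; now apply S1min|right; right; now split].
  - now right.
  - intros u [Hu|Hu]; [right; right; now split|right; left; now apply S2max].
  - intros u [[_ [_ Hu]]|[_ [Hu _]]]; [now left|now right].
Qed.

(** * Alternating walks and augmentation of a disjoint system *)

Variables A B : V -> Prop.

Definition disjoint_system (n : nat) (Ps : nat -> dpath V) : Prop :=
  (forall i, i < n -> AB_path G A B (Ps i)) /\
  (forall i j z, i < n -> j < n -> i <> j -> pset (Ps i) z -> pset (Ps j) z -> False).

Section System.
Variable n : nat.

Definition on_system (Ps : nat -> dpath V) (z : V) : Prop :=
  exists i, i < n /\ pset (Ps i) z.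

(** The end points may also lie off the system, so that the first and last pieces of a walk count as
    jumps. *)
Definition jump (Ps : nat -> dpath V) (J : dpath V) (v w : V) : Prop :=
  G J /\ from_to J v w /\
  (forall z, pset J z -> on_system Ps z -> z = v \/ z = w) /\
  (forall z, pset J z -> A z -> z = v) /\
  (forall z, pset J z -> B z -> z = w).

(* [finishable Ps m w]: an alternating walk that has just arrived at [w] can be
   completed to [B] using [m] more jumps, each preceded by a nontrivial step
   backwards along a path of the system. *)
Fixpoint finishable (Ps : nat -> dpath V) (m : nat) (w : V) : Prop :=
  match m with
  | 0 => B w /\ ~ on_system Ps w
  | S m => exists i v J w', i < n /\ pord (Ps i) v w /\ v <> w /\
             jump Ps J v w' /\ finishable Ps m w'
  end.

(** For a disjoint system the third clause keeps [a] off the system: otherwise [a = w] would be the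
    first point of its path, leaving no room for a step backwards. *)
Definition augmenting (Ps : nat -> dpath V) (m : nat) : Prop :=
  exists J a w, jump Ps J a w /\ A a /\
    (forall z, pset J z -> on_system Ps z -> z = w) /\ finishable Ps m w.

(** Any other common point would allow [J1] and [J] to be spliced into a single first jump from [a]
    to [w'], giving an augmenting walk with only [q] further jumps. If [w = w'], then [J1] itself
    already starts such a shorter walk. *)
Lemma jump_meets_first_jump Ps m J1 a w i q J v w' x :
  (forall q, q < S m -> ~ augmenting Ps q) ->
  jump Ps J1 a w -> A a -> (forall z, pset J1 z -> on_system Ps z -> z = w) ->
  on_system Ps w ->
  q <= m -> i < n -> pset (Ps i) v -> jump Ps J v w' -> finishable Ps q w' ->
  pset J x -> pset J1 x -> x = v /\ x = w.
Proof.
  intros Hmin HJ1 Aa off1 Pw Hq Hi Pv HJ fin Jx J1x.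
  assert (Pv' : on_system Ps v) by now exists i.
  assert (ww' : w <> w').
  { intros <-. apply (Hmin q); [lia|]. now exists J1, a, w. }
  destruct HJ1 as [GJ1 [ft1 [_ [A1 B1]]]]. destruct HJ as [GJ [ft [off [A2 B2]]]].
  destruct (classic (x = w)) as [->|xw].
  - destruct (off w Jx Pw) as [->|E]; [now split|now elim ww'].
  - exfalso.
    destruct (splice J1 J a w v w' x) as [t0 [K [J1t [Jt [tx [GK [ftK HK]]]]]]];
      try assumption.
    assert (tw : t0 <> w).
    { intros ->. apply xw. apply pord_antisym with J1; try assumption.
      now apply (proj2 ft1). }
    assert (Koff : forall z, pset K z -> on_system Ps z -> z = w').
    { intros z Kz Pz. destruct (HK z Kz) as [Hz|Hz].
      - exfalso. destruct (pord_dom _ _ _ GJ1 Hz) as [J1z _].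
        assert (z = w) as -> by now apply off1.
        apply tw. apply pord_antisym with J1; try assumption. now apply (proj2 ft1).
      - destruct (pord_dom _ _ _ GJ Hz) as [_ Jz].
        destruct (off z Jz Pz) as [->|]; [|assumption].
        exfalso. apply tw. apply off1; [assumption|].
        assert (t0 = v) as ->; [|assumption].
        apply pord_antisym with J; try assumption. now apply (proj1 ft). }
    apply (Hmin q); [lia|]. exists K, a, w'.
    repeat split; try assumption; try apply ftK.
    + intros z Kz Pz. right. now apply Koff.
    + intros z Kz Az. destruct (HK z Kz) as [Hz|Hz].
      * apply A1; [|assumption]. now apply (pord_dom _ _ _ GJ1 Hz).
      * destruct (pord_dom _ _ _ GJ Hz) as [_ Jz]. assert (z = v) as -> by now apply A2.
        assert (t0 = v) as <-; [|now apply A1].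
        apply pord_antisym with J; try assumption. now apply (proj1 ft).
    + intros z Kz Bz. destruct (HK z Kz) as [Hz|Hz].
      * exfalso. destruct (pord_dom _ _ _ GJ1 Hz) as [J1z _].
        assert (z = w) as -> by now apply B1.
        apply tw. apply pord_antisym with J1; try assumption. now apply (proj2 ft1).
      * apply B2; [|assumption]. now apply (pord_dom _ _ _ GJ Hz).
Qed.

(* Among all augmenting walks for [Ps] take one with the fewest jumps. Rerouting
   the path it first hits through its first jump leaves the remaining jumps
   valid, since any interference would yield a shorter augmenting walk. *)
Lemma augment m : forall Ps, disjoint_system n Ps -> augmenting Ps m ->
  exists Ps', disjoint_system (S n) Ps'.
Proof.
  induction m as [m IH] using lt_wf_ind. intros Ps sys aug.
  destruct (classic (exists q, q < m /\ augmenting Ps q)) as [[q [Hq Hq']]|Hmin];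
    [now apply (IH q Hq Ps)|].
  destruct aug as [J1 [a [w [HJ1 [Aa [off1 fin]]]]]].
  destruct sys as [AB dis].
  destruct m as [|m].
  - destruct fin as [Bw Pw].
    destruct HJ1 as [GJ1 [ft1 [_ [A1 B1]]]].
    assert (new : forall z i, i < n -> pset J1 z -> pset (Ps i) z -> False).
    { intros z i Hi J1z Piz. apply Pw.
      assert (on_system Ps z) by now exists i.
      now rewrite <- (off1 z). }
    (* With no further jumps, [J1] is an A-B-path avoiding the system and becomes the path with
       index [n]. *)
    exists (fun i => if Nat.eq_dec i n then J1 else Ps i). split.
    + intros i Hi. destruct (Nat.eq_dec i n) as [_|]; [|apply AB; lia].
      split; [assumption|split].
      * exists a. split; [apply ft1|]. intros z. split; [intros []; auto|intros ->].
        split; [apply ft1|assumption].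
      * exists w. split; [apply ft1|]. intros z. split; [intros []; auto|intros ->].
        split; [apply ft1|assumption].
    + intros i j z Hi Hj ij.
      destruct (Nat.eq_dec i n), (Nat.eq_dec j n); intros H1 H2.
      * lia.
      * apply (new z j); [lia|assumption..].
      * apply (new z i); [lia|assumption..].
      * apply (dis i j z); [lia|lia|assumption..].
  - destruct fin as [j [v [J2 [w2 [Hj [vw [vw' [HJ2 fin]]]]]]]].
    assert (Hmin' : forall q, q < S m -> ~ augmenting Ps q)
      by (intros q Hq H; apply Hmin; now exists q).
    destruct (AB j Hj) as [GPj [[aj [minj Aj]] [bj [maxj Bj]]]].
    destruct (pord_dom _ _ _ GPj vw) as [Pv Pw].
    assert (Pw' : on_system Ps w) by now exists j.
    pose proof (proj2 maxj w Pw) as wbj.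
    destruct (segment_from_to (Ps j) w bj GPj wbj) as [GS ftS].
    (* Path [j] is rerouted to enter through [J1] and continue from [w], which frees its part before
       [w]. *)
    pose (Q := Defs.concat J1 (segment (Ps j) w bj)).
    assert (vnle : forall z, pord (Ps j) w z -> pord (Ps j) z v -> False).
    { intros z H1 H2. apply vw'. apply pord_antisym with (Ps j); try assumption.
      now apply pord_trans with z. }
    assert (inter : forall x i q J v' w', q <= m -> i < n -> pset (Ps i) v' ->
        jump Ps J v' w' -> finishable Ps q w' -> pset J x -> pset J1 x ->
        x = v' /\ x = w).
    { intros x i q J v' w'; intros.
      apply (jump_meets_first_jump Ps m J1 a w i q J v' w'); assumption. }
    assert (HJ1' := HJ1). destruct HJ1' as [GJ1 [ft1 [_ [A1 B1]]]].
    assert (GQ : G Q).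
    { apply (proj2 (proj2 (proj2 Gspace))); try assumption. exists w. split; [|split; [apply ft1|apply ftS]].
      intros z. split.
      - intros [J1z [Pz _]]. apply off1; [assumption|now exists j].
      - intros ->. split; [exact (proj1 (proj2 ft1))|exact (proj1 (proj1 ftS))]. }
    assert (minQ : is_min Q a).
    { split; [left; apply ft1|]. intros z [Hz|Hz]; [left; now apply ft1|].
      right; right. split; [apply ft1|assumption]. }
    assert (maxQ : is_max Q bj).
    { split; [right; exact (proj1 (proj2 ftS))|]. intros z [Hz|Hz]; [|right; left; now apply ftS].
      right; right. split; [assumption|exact (proj1 (proj2 ftS))]. }
    pose (Ps' := fun i => if Nat.eq_dec i j then Q else Ps i).
    assert (Qdis : forall i z, i < n -> i <> j -> pset (Ps i) z -> pset Q z -> False).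
    { intros i z Hi ij Pz [Hz|[Hz _]]; [|now apply (dis i j z)].
      apply (dis i j z); try assumption.
      assert (z = w) as ->; [|assumption]. apply off1; [assumption|now exists i]. }
    assert (sys' : disjoint_system n Ps').
    { split.
      - intros i Hi. unfold Ps'. destruct (Nat.eq_dec i j) as [_|_]; [|now apply AB].
        split; [assumption|split].
        + exists a. split; [assumption|]. intros z. split.
          * intros [[Hz|[Pz [Hz _]]] Az]; [now apply A1|]. exfalso.
            assert (z = aj) as -> by now apply Aj.
            apply (vnle aj); [assumption|]. now apply minj.
          * intros ->. split; [apply minQ|assumption].
        + exists bj. split; [assumption|]. intros z. split.
          * intros [[Hz|[Pz _]] Bz]; apply Bj; split; try assumption.
            now rewrite (B1 z Hz Bz).
          * intros ->. split; [apply maxQ|now apply Bj].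
      - intros i l z Hi Hl il. unfold Ps'.
        destruct (Nat.eq_dec i j) as [->|ij], (Nat.eq_dec l j) as [->|lj]; intros H1 H2.
        + now apply il.
        + now apply (Qdis l z).
        + now apply (Qdis i z).
        + now apply (dis i l z). }
    assert (on' : forall z, on_system Ps' z -> on_system Ps z \/ pset J1 z).
    { intros z [i [Hi Hz]]. unfold Ps' in Hz. destruct (Nat.eq_dec i j).
      - destruct Hz as [Hz|[Hz _]]; [now right|left; now exists j].
      - left. now exists i. }
    assert (transfer : forall q w', q <= m -> finishable Ps q w' -> finishable Ps' q w').
    { induction q as [|q IHq]; intros w' Hq.
      - intros [Bw' Pw'']. split; [assumption|]. intros H. destruct (on' _ H) as [H'|H'].
        + now apply Pw''.
        + apply Pw''. now rewrite (B1 w').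
      - intros [i [v' [J [w'' [Hi [Hv [Hv' [HJ Hfin]]]]]]]].
        destruct (AB i Hi) as [GPi _].
        destruct (pord_dom _ _ _ GPi Hv) as [Pv' Pw''].
        exists i, v', J, w''. split; [assumption|]. split.
        { unfold Ps'. destruct (Nat.eq_dec i j) as [->|]; [|assumption].
          destruct (pord_total (Ps j) v' w) as [H|H]; try assumption.
          - destruct (classic (v' = w)) as [->|Hne].
            + right; left. assert (pord (Ps j) w w) by now apply pord_refl.
              repeat split; try assumption; now apply maxj.
            (* A later step back to a point of path [j] before [w] could be taken directly after
               [J1], shortening the walk. Hence later steps on path [j] stay in the part kept by
               [Q]. *)
            + exfalso. apply (Hmin' (S q)); [lia|]. exists J1, a, w.
              split; [assumption|]. split; [assumption|]. split; [assumption|].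
              now exists j, v', J, w''.
          - right; left. repeat split; try assumption; try (now apply maxj).
            now apply pord_trans with v'. }
        split; [assumption|]. split; [|apply IHq; [lia|assumption]].
        assert (HJ' := HJ). destruct HJ' as [GJ [ft [off [A2 B2]]]].
        split; [assumption|]. split; [assumption|]. split; [|split; assumption].
        intros z Jz Hz. destruct (on' z Hz) as [H|H]; [now apply off|].
        (* A contact with the new system that is not one with the old lies on [J1], and [J] can meet
           [J1] only in its starting point. *)
        left. apply (inter z i q J v' w''); try assumption. lia. }
    assert (J2J1 : forall z, pset J2 z -> pset J1 z -> False).
    { intros z H2 H1. destruct (inter z j m J2 v w2) as [-> E]; try assumption; try lia.
      now apply vw'. }
    destruct HJ2 as [GJ2 [ft2 [off2 [A2 B2]]]].
    pose proof (proj2 minj v Pv) as ajv.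
    destruct (segment_from_to (Ps j) aj v GPj ajv) as [GS' ftS'].
    (* The freed start of path [j] followed by [J2] replaces the first two jumps. Splicing avoids
       having to decide whether [J2] ends on that freed start. *)
    destruct (splice (segment (Ps j) aj v) J2 aj v v w2 v)
      as [t0 [K [_ [_ [_ [GK [ftK HK]]]]]]]; try assumption;
      [exact (proj1 (proj2 ftS'))|exact (proj1 (proj1 ft2))|].
    assert (HK' : forall z, pset K z -> (pset (Ps j) z /\ pord (Ps j) z v) \/ pset J2 z).
    { intros z Kz. destruct (HK z Kz) as [[[Hz [_ Hz']] _]|Hz]; [now left|].
      right. now apply (pord_dom _ _ _ GJ2 Hz). }
    assert (low : forall z, pset (Ps j) z -> pord (Ps j) z v -> ~ on_system Ps' z).
    { intros z Pz zv [i [Hi Hz]]. unfold Ps' in Hz. destruct (Nat.eq_dec i j).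
      - destruct Hz as [Hz|[_ [Hz _]]]; [|now apply (vnle z)].
        assert (z = w) as -> by (apply off1; [assumption|now exists j]).
        apply (vnle w); [now apply pord_refl|assumption].
      - now apply (dis i j z). }
    assert (Koff : forall z, pset K z -> on_system Ps' z -> z = w2).
    { intros z Kz Hz. destruct (HK' z Kz) as [[Pz zv]|J2z]; [now elim (low z)|].
      destruct (on' z Hz) as [H|H]; [|now elim (J2J1 z)].
      destruct (off2 z J2z H) as [->|]; [|assumption].
      elim (low v); try assumption. now apply pord_refl. }
    apply (IH m (Nat.lt_succ_diag_r m) Ps' sys'). exists K, aj, w2.
    split; [|split; [now apply Aj|split; [assumption|now apply transfer]]].
    split; [assumption|]. split; [assumption|]. split; [|split].
    + intros z Kz Hz. right. now apply Koff.
    + intros z Kz Az. apply Aj. destruct (HK' z Kz) as [[Pz _]|J2z]; [now split|].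
      assert (z = v) as -> by now apply A2. now split.
    + intros z Kz Bz. destruct (HK' z Kz) as [[Pz zv]|J2z]; [|now apply B2].
      exfalso. assert (z = bj) as -> by now apply Bj. now apply (vnle bj).
Qed.

(** * The separator formed by launch bounds *)

Definition launchable (Ps : nat -> dpath V) (v : V) : Prop :=
  exists m J w, jump Ps J v w /\ finishable Ps m w.

(** The last clause expresses the infimum in the form that a step backwards needs: a strictly
    earlier launchable point. If the path carries no launchable point, it forces [x] to be the
    maximum. *)
Definition launch_bound (Ps : nat -> dpath V) (i : nat) (x : V) : Prop :=
  pset (Ps i) x /\
  (forall v, pset (Ps i) v -> launchable Ps v -> pord (Ps i) x v) /\
  (forall z, pord (Ps i) x z -> x <> z ->
     exists v, launchable Ps v /\ pord (Ps i) v z /\ v <> z).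

(* The infimum of the launchable points of [Ps i], or its maximum if there are none. *)
Lemma launch_bound_exists Ps i : AB_path G A B (Ps i) -> exists x, launch_bound Ps i x.
Proof.
  intros [GP [_ [b [maxb _]]]].
  destruct (classic (exists v, pset (Ps i) v /\ launchable Ps v)) as [He|He].
  - destruct (proj1 Gspace _ GP) as [_ comp].
    destruct (comp (fun v => pset (Ps i) v /\ launchable Ps v) (fun v h => proj1 h) He)
      as [_ [x [[Px [xle xinf]] _]]].
    exists x. split; [assumption|]. split; [now auto|].
    intros z xz nxz. apply NNPP. intros Hno. apply nxz.
    destruct (pord_dom _ _ _ GP xz) as [_ Pz].
    apply pord_antisym with (Ps i); try assumption. apply xinf; [assumption|].
    intros v [Pv Lv]. destruct (pord_total (Ps i) z v) as [H|H]; try assumption.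
    destruct (classic (v = z)) as [->|Hne]; [assumption|].
    exfalso. apply Hno. now exists v.
  - exists b. split; [apply maxb|]. split.
    + intros v Pv Lv. exfalso. apply He. now exists v.
    + intros z bz nbz. exfalso. apply nbz.
      apply pord_antisym with (Ps i); try assumption. apply maxb.
      now apply (pord_dom _ _ _ GP bz).
Qed.

Lemma separator_or_augment Ps : disjoint_system n Ps ->
  (exists X : V -> Prop, (forall x, X x -> vertices G x) /\ card_lt X (S n) /\
      (forall R, AB_path G A B R -> meets X R))
  \/ exists Ps', disjoint_system (S n) Ps'.
Proof.
  intros sys.
  destruct (classic (exists m, augmenting Ps m)) as [[m Hm]|noaug];
    [right; now apply (augment m Ps)|left].
  (* An A-B-path supplies the inhabitant of [V] that [epsilon] requires; if there is none, the empty
     set separates. *)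
  destruct (classic (exists R, AB_path G A B R)) as [[R0 HR0]|noR].
  2: { exists (fun _ => False). split; [tauto|]. split; [exists nil; simpl; split; [lia|tauto]|].
       intros R HR. exfalso. apply noR. now exists R. }
  destruct HR0 as [_ [[r0 _] _]].
  pose (f i := epsilon (inhabits r0) (launch_bound Ps i)).
  destruct sys as [AB dis].
  assert (Hf : forall i, i < n -> launch_bound Ps i (f i)).
  { intros i Hi. apply epsilon_spec. apply launch_bound_exists. now apply AB. }
  clearbody f.
  exists (fun x => exists i, i < n /\ x = f i).
  split; [|split].
  { intros x [i [Hi ->]]. exists (Ps i). split; [apply (AB i Hi)|apply (Hf i Hi)]. }
  { exists (map f (seq 0 n)). rewrite length_map, length_seq. split; [lia|].
    intros x [i [Hi ->]]. apply in_map. apply in_seq. lia. }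
  intros R [GR [[r [minR AR]] [s [maxR BR]]]]. apply NNPP. intros avoid.
  assert (Rf : forall i, i < n -> ~ pset R (f i)).
  { intros i Hi H. apply avoid. exists (f i). split; [now exists i|assumption]. }
  assert (GPs : forall i, i < n -> G (Ps i)) by (intros i Hi; apply (AB i Hi)).
  (* The part of [R] up to [e] leaves the initial segments of the paths for the
     last time at a point from which it jumps to [e]. *)
  assert (key : forall e m, pset R e -> finishable Ps m e ->
     (forall i u, i < n -> pset (Ps i) u -> pord R u e -> pord (Ps i) u (f i) \/ u = e) ->
     (forall i, i < n -> ~ pord (Ps i) e (f i)) -> False).
  { intros e m Re fin lower ehigh.
    assert (mkjump : forall v, pord R v e ->
      (forall z, pord R v z -> pord R z e -> on_system Ps z -> z = v \/ z = e) ->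
      jump Ps (segment R v e) v e).
    { intros v ve off. destruct (segment_from_to R v e GR ve) as [GS ftS].
      destruct (pord_dom _ _ _ GR ve) as [Rv _].
      split; [assumption|]. split; [assumption|]. split; [|split].
      - intros z [_ [H1 H2]] Hz. now apply off.
      - intros z [Rz [vz _]] Az. assert (z = r) as -> by now apply AR.
        apply pord_antisym with R; try assumption. now apply minR.
      - intros z [Rz [_ ze]] Bz. assert (z = s) as -> by now apply BR.
        apply pord_antisym with R; try assumption. now apply maxR. }
    pose (C i u := i < n /\ pord R u e /\ pord (Ps i) u (f i)).
    destruct (classic (exists i u, i < n /\ C i u)) as [He|He].
    (* The reversed order of [R] turns the least point of the union into the last point [v] of [R]
       up to [e] that is at or below a bound. *)
    - destruct (finite_union_least (pset R) (fun x y => pord R y x) n C)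
        as [j [v [Hj [[_ [ve vf]] last]]]].
      + intros x y Rx Ry. now apply pord_total.
      + intros x y z H1 H2. now apply pord_trans with y.
      + intros i z [_ [H _]]. now apply (pord_dom _ _ _ GR H).
      + intros i Hi [u [_ [ue uf]]].
        destruct (AB i Hi) as [GP [[ai [mini _]] _]].
        destruct (Hf i Hi) as [Pf _].
        (* [C i] is the intersection of two segments, both members of [G], so compatibility gives it
           a last point. *)
        destruct (segment_from_to (Ps i) ai (f i) GP (proj2 mini _ Pf)) as [GL _].
        destruct (segment_from_to R r e GR (proj2 minR _ Re)) as [GS _].
        destruct (inter_greatest _ _ GS GL) as [m0 [[[Rm [_ me]] [Pm [_ mf]]] great]].
        { exists u. destruct (pord_dom _ _ _ GR ue) as [Ru _].
          destruct (pord_dom _ _ _ GP uf) as [Pu _].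
          repeat split; try assumption; [now apply minR|now apply mini]. }
        exists m0. split; [now split|]. intros y [_ [ye yf]]. apply great.
        destruct (pord_dom _ _ _ GR ye) as [Ry _].
        destruct (pord_dom _ _ _ GP yf) as [Py _].
        repeat split; try assumption; [now apply minR|now apply mini].
      + exact He.
      + destruct (pord_dom _ _ _ GR ve) as [Rv _].
        destruct (pord_dom _ _ _ (GPs j Hj) vf) as [Pv _].
        assert (E : v = f j).
        { apply pord_antisym with (Ps j); try assumption; [now apply GPs|].
          apply (Hf j Hj); [assumption|]. exists m, (segment R v e), e.
          split; [|assumption]. apply mkjump; [assumption|].
          intros z vz ze [i [Hi Pz]]. destruct (lower i z Hi Pz ze) as [zf|]; [left|now right].
          apply pord_antisym with R; try assumption. now apply (last i). }
        apply (Rf j Hj). now rewrite <- E.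
    (* If [R] meets no initial part before [e], its segment from [r] to [e] starts an augmenting
       walk. *)
    - apply noaug. exists m, (segment R r e), r, e.
      assert (off : forall z, pord R z e -> on_system Ps z -> z = e).
      { intros z ze [i [Hi Pz]]. destruct (lower i z Hi Pz ze) as [zf|]; [|assumption].
        exfalso. apply He. now exists i, z. }
      split; [|split; [now apply AR|split; [|assumption]]].
      + apply mkjump; [now apply minR|]. intros z _ ze Hz. right. now apply off.
      + intros z [_ [_ ze]] Hz. now apply off. }
  pose (C i u := i < n /\ pset R u /\ pord (Ps i) (f i) u).
  assert (split_at : forall i u, i < n -> pset (Ps i) u ->
    pord (Ps i) u (f i) \/ pord (Ps i) (f i) u).
  { intros i u Hi Pu. apply pord_total; [now apply GPs|assumption|apply (Hf i Hi)]. }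
  destruct (classic (exists i u, i < n /\ C i u)) as [He|He].
  - destruct (finite_union_least (pset R) (pord R) n C)
      as [j [e [Hj [[_ [Re ef]] first]]]].
    + intros x y Rx Ry. now apply pord_total.
    + intros x y z H1 H2. now apply pord_trans with y.
    + now intros i z [_ [H _]].
    + intros i Hi [u [_ [Ru uf]]].
      destruct (AB i Hi) as [GP [_ [bi [maxi _]]]].
      destruct (Hf i Hi) as [Pf _].
      destruct (segment_from_to (Ps i) (f i) bi GP (proj2 maxi _ Pf)) as [GL _].
      destruct (inter_least _ _ GR GL) as [m0 [[Rm [Pm [mf _]]] least]].
      { exists u. destruct (pord_dom _ _ _ GP uf) as [_ Pu].
        repeat split; try assumption. now apply maxi. }
      exists m0. split; [now split|]. intros y [_ [Ry yf]]. apply least.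
      destruct (pord_dom _ _ _ GP yf) as [_ Py].
      repeat split; try assumption. now apply maxi.
    + exact He.
    (* As [R] avoids the bounds, [e] is strictly beyond [f j]. A step back from [e] to an earlier
       launchable point makes [e] finishable with one more jump. *)
    + assert (fe : f j <> e) by (intros E; apply (Rf j Hj); now rewrite E).
      destruct (pord_dom _ _ _ (GPs j Hj) ef) as [_ Pe].
      destruct (proj2 (proj2 (Hf j Hj)) e ef fe) as [v [[m [J [w' [HJ fin]]]] [ve nve]]].
      apply (key e (S m)); try assumption.
      * now exists j, v, J, w'.
      * intros i u Hi Pu ue. destruct (split_at i u Hi Pu) as [H|H]; [now left|right].
        apply pord_antisym with R; try assumption. apply (first i); [assumption|].
        split; [assumption|]. split; [|assumption]. now apply (pord_dom _ _ _ GR ue).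
      * intros i Hi H. apply fe. destruct (Nat.eq_dec i j) as [->|ij].
        -- apply pord_antisym with (Ps j); try assumption. now apply GPs.
        -- exfalso. apply (dis i j e); try assumption.
           now apply (pord_dom _ _ _ (GPs i Hi) H).
  (* If [R] never gets beyond a bound, its end [s] takes the role of [e]: on a path of the system it
     would be the maximum, hence beyond the bound. So [s] is finishable with no jumps. *)
  - assert (off : ~ on_system Ps s).
    { intros [i [Hi Ps_s]]. apply He. exists i, s.
      split; [assumption|]. split; [assumption|]. split; [apply maxR|].
      destruct (AB i Hi) as [GP [_ [bi [maxi Bi]]]].
      assert (s = bi) as ->. { apply Bi. split; [assumption|]. now apply BR. }
      apply maxi. apply (Hf i Hi). }
    apply (key s 0); [apply maxR|split; [now apply BR|assumption]| |].
    + intros i u Hi Pu us. destruct (split_at i u Hi Pu) as [H|H]; [now left|].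
      exfalso. apply He. exists i, u. split; [assumption|]. split; [assumption|].
      split; [|assumption]. now apply (pord_dom _ _ _ GR us).
    + intros i Hi H. apply off. exists i. split; [assumption|].
      now apply (pord_dom _ _ _ (GPs i Hi) H).
Qed.

End System.
End DipathSpace.

(** * Induction on the number of paths *)

Theorem mainTheorem8 (V : Type) (G : dpath V -> Prop) (A B : V -> Prop) (k : nat) :
  dipath_space G ->
  (forall a, A a -> vertices G a) ->
  (forall b, B b -> vertices G b) ->
  (exists X : V -> Prop,
      (forall x, X x -> vertices G x) /\ card_lt X k /\
      (forall R, AB_path G A B R -> meets X R))
  \/
  (exists Ps : nat -> dpath V,
      (forall i, i < k -> AB_path G A B (Ps i)) /\
      (forall i j z, i < k -> j < k -> i <> j -> pset (Ps i) z -> pset (Ps j) z -> False)).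
Proof.
  intros Gspace _ _. induction k as [|k [[X [XV [[l [Hl Xl]] sep]]]|[Ps sys]]].
  (* For [k = 0] no index is constrained, so an arbitrary value serves. *)
  - right. exists (fun _ => DPath (fun _ => False) (fun _ _ => False)). split; intros; lia.
  - left. exists X. split; [assumption|]. split; [|assumption].
    exists l. split; [lia|assumption].
  - exact (separator_or_augment V G Gspace A B k Ps sys).
Qed.
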